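(* For every positive integer $m$, $$\sum_{n = 1}^{\infty}\frac{\coth(\pi n)}{n^{4m + 3}} = 2^{4m+2}\pi^{4m + 3}\sum_{k = 0}^{2m + 2}\frac{(-1)^{k+1}B_{2k}\,B_{4m + 4 -2k}}{(2k)!\,(4m+4-2k)!},$$ where $B_j$ denotes the $j$-th Bernoulli number.
   Context: The Bernoulli numbers $B_j$ ($j \geqslant 0$) are defined by the exponential generating function $\sum_{j\geqslant 0}B_{j}\frac{z^j}{j!}=\frac{z}{\exp(z)-1}$. Here $\coth$ is the hyperbolic cotangent. *)

(* Defs.v *)
From Stdlib Require Import Reals Factorial Lra Lia.
From Coquelicot Require Import Coquelicot.
Open Scope R_scope.

Definition coth (x : R) : R := cosh x / sinh x.

(* [B] is the sequence of Bernoulli numbers: its exponential generating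
   function converges to z / (exp z - 1) near 0.  The neighbourhood is
   punctured because Rocq's total division gives the quotient a meaningless
   value at z = 0.  By [is_bernoulli_ex] and [is_bernoulli_unique] below,
   exactly one sequence has this property. *)
Definition is_bernoulli (B : nat -> R) : Prop :=
  locally' 0 (fun z : R =>
    is_pseries (fun j : nat => B j / INR (fact j)) z (z / (exp z - 1))).

Lemma is_bernoulli_CV_radius (B : nat -> R) :
  is_bernoulli B -> Rbar_lt 0 (CV_radius (fun j : nat => B j / INR (fact j))).
Proof.
intros [d Hd].
assert (Hd0 := cond_pos d).
assert (Hz : is_pseries (fun j => B j / INR (fact j)) (d / 2)
               (d / 2 / (exp (d / 2) - 1))).
{ apply Hd; [|lra].
  change (Rabs (d / 2 - 0) < d).
  rewrite Rminus_0_r, Rabs_pos_eq; lra. }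
apply Rbar_lt_le_trans with (Finite (Rabs (d / 2))).
{ simpl. rewrite Rabs_pos_eq; lra. }
apply Rbar_not_lt_le. intros Hlt.
apply (CV_disk_outside _ _ Hlt).
apply ex_series_lim_0.
exists (d / 2 / (exp (d / 2) - 1)).
now apply is_pseries_R.
Qed.

Lemma is_bernoulli_unique (B B' : nat -> R) :
  is_bernoulli B -> is_bernoulli B' -> forall n, B n = B' n.
Proof.
intros HB HB' n.
assert (Ra := is_bernoulli_CV_radius B HB).
assert (Rb := is_bernoulli_CV_radius B' HB').
set (a := fun j => B j / INR (fact j)) in *.
set (b := fun j => B' j / INR (fact j)) in *.
assert (Heq : locally' 0 (fun z => PSeries a z = PSeries b z)).
{ generalize (filter_and _ _ HB HB'). apply filter_imp. intros z [H1 H2].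
  transitivity (z / (exp z - 1)); [exact (is_pseries_unique _ _ _ H1)|symmetry].
  exact (is_pseries_unique _ _ _ H2). }
assert (Hc : forall c, Rbar_lt 0 (CV_radius c) ->
             filterlim (PSeries c) (locally' 0) (locally (PSeries c 0))).
{ intros c Hc.
  apply (filterlim_filter_le_1 (F := locally 0)).
  - intros P. unfold locally', within. apply filter_imp. auto.
  - assert (Hcc : continuity_pt (PSeries c) 0)
      by (apply PSeries_continuity; now rewrite Rabs_R0).
    apply continuity_pt_filterlim in Hcc. exact Hcc. }
assert (H0 : PSeries a 0 = PSeries b 0).
{ assert (FF : ProperFilter (locally' 0)) by exact (Rbar_locally'_filter 0).
  apply (filterlim_locally_unique (F := locally' 0) (PSeries a)).
  - now apply Hc.
  - apply filterlim_ext_loc with (PSeries b).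
    + generalize Heq. apply filter_imp. intros z Hz. now symmetry.
    + now apply Hc. }
assert (Hn : a n = b n).
{ apply PSeries_ext_recip; trivial.
  destruct Heq as [d Hd]. exists d. intros z Hz.
  destruct (Req_dec z 0) as [->|Hz0]; [exact H0|now apply Hd]. }
unfold a, b in Hn.
assert (Hf := INR_fact_neq_0 n).
replace (B n) with (B n / INR (fact n) * INR (fact n)) by (field; trivial).
rewrite Hn. field; trivial.
Qed.

(* For j <= n, [bern_coef n j] is the coefficient of z ^ j in z / (exp z - 1),
   obtained by inverting (exp z - 1) / z. *)
Fixpoint bern_coef (n : nat) : nat -> R :=
  match n with
  | O => fun _ => 1
  | S p => fun k =>
      if Nat.leb k p then bern_coef p k
      else - sum_f_R0 (fun j => bern_coef p j * / INR (fact (p + 2 - j))) p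
  end.

Lemma bern_coef_stable (n k : nat) :
  (k <= n)%nat -> bern_coef n k = bern_coef k k.
Proof.
induction n as [|n IH]; intros Hk.
- now replace k with O by lia.
- destruct (Nat.eq_dec k (S n)) as [->|Hne]; [easy|].
  simpl. destruct (Nat.leb_spec k n); [now apply IH|lia].
Qed.

Lemma bern_coef_S (n : nat) :
  bern_coef (S n) (S n) =
  - sum_f_R0 (fun j => bern_coef j j * / INR (fact (S (S n - j)))) n.
Proof.
change (bern_coef (S n) (S n)) with
  (if Nat.leb (S n) n then bern_coef n (S n)
   else - sum_f_R0 (fun j => bern_coef n j * / INR (fact (n + 2 - j))) n).
destruct (Nat.leb_spec (S n) n); [lia|].
f_equal. apply sum_eq. intros j Hj.
rewrite bern_coef_stable; [|lia].
now replace (n + 2 - j)%nat with (S (S n - j)) by lia.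
Qed.

Lemma inv_fact_le_pow (n : nat) : / INR (fact (S n)) <= (/ 2) ^ n.
Proof.
rewrite pow_inv. apply Rinv_le_contravar.
- apply pow_lt; lra.
- induction n as [|n IH]; [simpl; lra|].
  change (fact (S (S n))) with ((S (S n)) * fact (S n))%nat.
  rewrite mult_INR. simpl pow.
  apply Rmult_le_compat; trivial; try lra.
  + apply pow_le; lra.
  + change 2 with (INR 2). apply le_INR. lia.
Qed.

Lemma bern_coef_le_1 (n : nat) : Rabs (bern_coef n n) <= 1.
Proof.
induction n as [n IH] using (well_founded_induction Wf_nat.lt_wf).
destruct n as [|n]; [simpl; rewrite Rabs_R1; lra|].
rewrite bern_coef_S, Rabs_Ropp.
apply Rle_trans with (sum_f_R0 (fun j => (/ 2) ^ (S n - j)) n).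
- eapply Rle_trans; [apply Rsum_abs|].
  apply sum_Rle. intros j Hj.
  rewrite Rabs_mult.
  rewrite <- (Rmult_1_l ((/ 2) ^ (S n - j))).
  assert (Hp : 0 < / INR (fact (S (S n - j)))).
  { apply Rinv_0_lt_compat, INR_fact_lt_0. }
  apply Rmult_le_compat; try apply Rabs_pos.
  + apply IH. lia.
  + rewrite Rabs_pos_eq; [apply inv_fact_le_pow|lra].
- replace (sum_f_R0 (fun j => (/ 2) ^ (S n - j)) n) with (1 - (/ 2) ^ S n).
  + assert (0 < (/ 2) ^ S n) by (apply pow_lt; lra). lra.
  + clear IH. induction n as [|n IH]; [simpl; lra|].
    rewrite decomp_sum; [|lia].
    change (pred (S n)) with n.
    rewrite (sum_eq _ (fun j => (/ 2) ^ (S n - j))); [|easy].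
    rewrite <- IH. rewrite Nat.sub_0_r. simpl. lra.
Qed.

Lemma CV_radius_ge_1 (a : nat -> R) :
  (forall n, Rabs (a n) <= 1) -> Rbar_le 1 (CV_radius a).
Proof.
intros Ha. apply (CV_radius_bounded a). exists 1. intros n.
now rewrite pow1, Rmult_1_r.
Qed.

Lemma is_pseries_expm1 (z : R) :
  z <> 0 -> is_pseries (fun n => / INR (fact (S n))) z ((exp z - 1) / z).
Proof.
intros Hz.
assert (H := is_pseries_decr_1 (fun n => / INR (fact n)) z (/ z) (exp z)).
simpl (_ 0%nat) in H.
replace ((exp z - 1) / z)
  with (scal (/ z) (plus (exp z) (opp (/ INR (fact 0))))).
- apply H; [|apply is_exp_Reals].
  change (/ z * z = 1). now field.
- change (/ z * (exp z + - / 1) = (exp z - 1) / z). now field.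
Qed.

Lemma is_bernoulli_ex : exists B : nat -> R, is_bernoulli B.
Proof.
set (b := fun n => bern_coef n n).
set (c := fun n => / INR (fact (S n))).
assert (Rb : Rbar_le 1 (CV_radius b)) by (apply CV_radius_ge_1, bern_coef_le_1).
assert (Rc : Rbar_le 1 (CV_radius c)).
{ apply CV_radius_ge_1. intros n. unfold c.
  assert (Hp : 0 < / INR (fact (S n))).
  { apply Rinv_0_lt_compat, INR_fact_lt_0. }
  rewrite Rabs_pos_eq; [|lra].
  eapply Rle_trans; [apply inv_fact_le_pow|].
  rewrite <- (pow1 n). apply pow_incr. lra. }
exists (fun n => b n * INR (fact n)).
exists (mkposreal 1 Rlt_0_1). intros z Hz Hz0.
assert (Hz1 : Rabs z < 1).
{ change (Rabs (z - 0) < 1) in Hz. now rewrite Rminus_0_r in Hz. }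
assert (Hb : is_pseries b z (PSeries b z)).
{ apply PSeries_correct, CV_radius_inside.
  eapply Rbar_lt_le_trans; [|exact Rb]. exact Hz1. }
assert (He : exp z - 1 <> 0).
{ intros He. apply Hz0. apply exp_inv. rewrite exp_0. lra. }
assert (Hm : PSeries b z * ((exp z - 1) / z) = 1).
{ rewrite <- (is_pseries_unique (PS_mult b c) z (PSeries b z * ((exp z - 1) / z))).
  - rewrite (PSeries_ext _ (fun n => match n with O => 1 | _ => 0 end)).
    + apply is_pseries_unique, is_pseries_R.
      apply is_series_decr_1.
      apply filterlim_ext with (fun _ => 0).
      * intros n. transitivity (sum_n (fun _ => 0) n).
        { rewrite sum_n_const. ring. }
        apply sum_n_ext. intros k. symmetry. apply Rmult_0_l.
      * replace (plus _ _) with 0; [apply filterlim_const|].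
        change (0 = 1 + - (1 * 1)). ring.
    + intros [|n]; unfold PS_mult, c.
      * unfold b. simpl. lra.
      * rewrite tech5, Nat.sub_diag. unfold b at 2. rewrite bern_coef_S.
        unfold b.
        change (INR (fact 1)) with 1. lra.
  - apply is_pseries_mult; trivial.
    + now apply is_pseries_expm1.
    + eapply Rbar_lt_le_trans; [|exact Rb]. exact Hz1.
    + eapply Rbar_lt_le_trans; [|exact Rc]. exact Hz1. }
apply is_pseries_ext with b.
{ intros n. assert (Hf := INR_fact_neq_0 n).
  change (b n = b n * INR (fact n) / INR (fact n)). now field. }
replace (z / (exp z - 1)) with (PSeries b z); trivial.
apply Rmult_eq_reg_r with ((exp z - 1) / z).
- rewrite Hm. field. now split.
- unfold Rdiv. apply Rmult_integral_contrapositive_currified; trivial.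
  now apply Rinv_neq_0_compat.
Qed.

(* Main.v *)
Require Import Defs.
From Stdlib Require Import Reals Factorial Lra Lia Psatz.
From Coquelicot Require Import Coquelicot.
Open Scope R_scope.

(** Everything rests on the partial fraction expansion
      coth u = 1/u + sum_(k >= 1) 2 u / (u^2 + pi^2 k^2)
    ([coth_partial_fractions]), used twice.

    At u = z / 2 with z small, expanding each fraction in powers of z^2 shows
    that z / (exp z - 1) = (z / 2) coth (z / 2) - z / 2 has the even
    coefficients -2 (-1)^k zeta(2k) / (2 pi)^(2k), with zeta(0) = -1/2.  By
    uniqueness of the Bernoulli numbers this is Euler's formula
    ([bernoulli_even]), and it turns the right-hand side of the theorem into
      (1/pi) sum_(k <= 2m+2) (-1)^(k+1) zeta(2k) zeta(4m+4-2k).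

    At u = pi n it turns the left-hand side into (1/pi) times
      zeta(4m+4) + sum_n sum_k 2 / (n^(4m+2) (n^2 + k^2)).
    The double sum is symmetric in disguise: adding the terms (n, k) and (k, n)
    gives (X^p + Y^p) X Y / (X + Y) with X = 1/n^2, Y = 1/k^2 and p = 2m+1.  As
    p is odd, X + Y divides X^p + Y^p and the fraction is an alternating sum of
    products X^(j+1) Y^(p-j) ([kernel_symmetrised]), which sums to products of
    zeta values.  The term zeta(4m+4) is the contribution of the two end
    indices k = 0 and k = 2m+2, because zeta(0) = -1/2.

    The expansion of coth is obtained by repeated halving.  The real part
    T(u, t) of coth (u + i t) satisfies 2 T(2u, 2t) = T(u, t) + T(u, pi/2 - t);
    iterating from t = 0 writes coth u as a trapezoidal sum of T over a regular
    subdivision of [0, pi/2] ([coth_trapezoid]).  Near the origin T(u, t) is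
    u / (u^2 + t^2), the real part of 1 / (u + i t), with an error O(u) uniform
    in t ([re_coth_approx]).  Replacing T by that fraction in the trapezoidal
    sum gives the partial sums of the series, with a total error that tends
    to 0. *)

(** * Hyperbolic functions near the origin *)

Lemma sinh_double (v : R) : sinh (2 * v) = 2 * sinh v * cosh v.
Proof.
unfold sinh, cosh. replace (- (2 * v)) with (- v + - v) by ring.
replace (2 * v) with (v + v) by ring. rewrite !exp_plus. field.
Qed.

Lemma cosh_double (v : R) : cosh (2 * v) = 1 + 2 * sinh v ^ 2.
Proof.
assert (E : exp v * exp (- v) = 1).
{ rewrite <- exp_plus, Rplus_opp_r. apply exp_0. }
unfold sinh, cosh. replace (- (2 * v)) with (- v + - v) by ring.
replace (2 * v) with (v + v) by ring. rewrite !exp_plus. nra.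
Qed.

Lemma cosh_sqr (v : R) : cosh v ^ 2 = 1 + sinh v ^ 2.
Proof.
assert (E : exp v * exp (- v) = 1).
{ rewrite <- exp_plus, Rplus_opp_r. apply exp_0. }
unfold sinh, cosh. nra.
Qed.

Lemma cosh_ge_1 (v : R) : 1 <= cosh v.
Proof. replace v with (2 * (v / 2)) by field. rewrite cosh_double. nra. Qed.

Lemma sinh_MVT (v : R) :
  0 < v -> exists c, 0 < c < v /\ sinh v = v * cosh c.
Proof.
intros Hv.
destruct (MVT_cor2 sinh cosh 0 v Hv) as [c [E Hc]].
{ intros c _. apply derivable_pt_lim_sinh. }
exists c. split; trivial. rewrite sinh_0 in E. lra.
Qed.

Lemma sinh_ge (v : R) : 0 < v -> v <= sinh v.
Proof.
intros Hv. destruct (sinh_MVT v Hv) as [c [_ ->]].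
generalize (cosh_ge_1 c). nra.
Qed.

(** The duplication formula cosh v = 1 + 2 sinh (v/2)^2 turns a crude linear
    bound on sinh into a quadratic bound on cosh v - 1. *)
Lemma cosh_le (v : R) : 0 < v <= 1 -> cosh v <= 1 + 5 * v ^ 2.
Proof.
intros Hv.
destruct (sinh_MVT (v / 2)) as [c [Hc E]]; [lra|].
assert (H3 : cosh c <= 3).
{ apply Rle_trans with (exp c).
  - unfold cosh. assert (exp (- c) < exp c) by (apply exp_increasing; lra). lra.
  - apply Rle_trans with (exp 1); [|apply exp_le_3].
    left. apply exp_increasing. lra. }
generalize (cosh_ge_1 c). intros H1.
replace v with (2 * (v / 2)) at 1 by field. rewrite cosh_double, E.
assert (cosh c ^ 2 <= 9) by nra.
assert (0 <= v ^ 2) by nra. nra.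
Qed.

Lemma sinh_le (v : R) : 0 < v <= 1 -> sinh v <= v + 5 * v ^ 3.
Proof.
intros Hv. destruct (sinh_MVT v) as [c [Hc ->]]; [lra|].
assert (H := cosh_le c ltac:(lra)).
assert (c ^ 2 <= v ^ 2) by nra. nra.
Qed.

Lemma sin_cubic_bounds (t : R) :
  0 <= t <= 2 -> t - t ^ 3 / 6 <= sin t <= t.
Proof.
intros Ht. split.
- destruct (sin_bound t 0) as [H _]; try lra.
  + generalize PI2_3_2. lra.
  + unfold sin_approx, sin_term in H. simpl in H. simpl. lra.
- destruct (Req_dec t 0) as [->|Hn]; [rewrite sin_0; lra|].
  left. apply sin_lt_x. lra.
Qed.

(** * The expansion of coth into partial fractions *)

(** The real part of coth (u + i t) for real u and t. *)
Definition re_coth (u t : R) : R :=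
  sinh u * cosh u / (sinh u ^ 2 + sin t ^ 2).

Lemma re_coth_0 (u : R) : 0 < u -> re_coth u 0 = coth u.
Proof.
intros Hu. assert (H := sinh_ge u Hu).
unfold re_coth, coth. rewrite sin_0. field. lra.
Qed.

(** The denominator (2 sinh u cosh u)^2 + (2 sin t cos t)^2 on the right factors
    as 4 (sinh u^2 + sin t^2) (sinh u^2 + cos t^2).  This is the duplication
    formula 2 coth (2 w) = coth w + coth (w + i pi/2), in real parts and with
    t + pi/2 reflected to pi/2 - t so that all angles remain in [0, pi/2]. *)
Lemma re_coth_split (u t : R) :
  0 < u -> re_coth u t + re_coth u (PI / 2 - t) = 2 * re_coth (2 * u) (2 * t).
Proof.
intros Hu. assert (Hs := sinh_ge u Hu).
unfold re_coth.
rewrite sinh_double, cosh_double, sin_2a, sin_shift.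
assert (Hc := cosh_sqr u). assert (Hb := sin2_cos2 t). unfold Rsqr in Hb.
assert (H1 : 0 < sinh u ^ 2 + sin t ^ 2) by nra.
assert (H2 : 0 < sinh u ^ 2 + cos t ^ 2) by nra.
replace ((2 * sinh u * cosh u) ^ 2 + (2 * sin t * cos t) ^ 2)
  with (4 * (sinh u ^ 2 + sin t ^ 2) * (sinh u ^ 2 + cos t ^ 2)).
- replace (1 + 2 * sinh u ^ 2) with
    ((sinh u ^ 2 + sin t ^ 2) + (sinh u ^ 2 + cos t ^ 2)) by nra.
  field. split; lra.
- replace (cos t ^ 2) with (1 - sin t ^ 2) by nra.
  replace ((2 * sinh u * cosh u) ^ 2) with (4 * sinh u ^ 2 * cosh u ^ 2) by ring.
  replace ((2 * sin t * cos t) ^ 2) with (4 * sin t ^ 2 * cos t ^ 2) by ring.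
  rewrite Hc. replace (cos t ^ 2) with (1 - sin t ^ 2) by nra. ring.
Qed.

(** The function coth w - 1/w extends analytically by 0 at w = 0, and its real
    part is O(v).  Over the common denominator, which is at least
    (v^2 + t^2)^2 / 9, every term of the numerator is v times a quantity of
    order 4 in (v, t). *)
Lemma re_coth_approx (v t : R) :
  0 < v <= 1 -> 0 <= t <= 2 ->
  Rabs (re_coth v t - v / (v ^ 2 + t ^ 2)) <= 700 * v.
Proof.
intros Hv Ht. unfold re_coth.
destruct (sin_cubic_bounds t Ht) as [Hl Hu].
assert (Hs1 := sinh_ge v (proj1 Hv)).
assert (Hs2 := sinh_le v Hv).
assert (Hc1 := cosh_ge_1 v).
assert (Hc2 := cosh_le v Hv).
revert Hl Hu Hs1 Hs2 Hc1 Hc2.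
generalize (sin t), (sinh v), (cosh v). intros a s c Hl Hu Hs1 Hs2 Hc1 Hc2.
assert (Hv2 : 0 < v ^ 2 <= 1) by nra.
assert (Ha3 : t / 3 <= a) by nra.
assert (Ha2 : t ^ 2 / 9 <= a ^ 2) by nra.
assert (Hw : 0 < v ^ 2 + t ^ 2) by nra.
assert (Hd : (v ^ 2 + t ^ 2) / 9 <= s ^ 2 + a ^ 2) by nra.
(* Each cubic or quartic bound below absorbs the higher powers using v <= 1. *)
assert (N1 : 0 <= s * c - v <= 35 * v ^ 3).
{ split; [nra|].
  apply Rle_trans with ((v + 5 * v ^ 3) * (1 + 5 * v ^ 2) - v).
  - assert (s * c <= (v + 5 * v ^ 3) * (1 + 5 * v ^ 2)) by
      (apply Rmult_le_compat; lra). lra.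
  - assert (0 < v ^ 3) by (apply pow_lt; lra).
    replace ((v + 5 * v ^ 3) * (1 + 5 * v ^ 2) - v) with
      (10 * v ^ 3 + 25 * (v ^ 3 * v ^ 2)) by ring. nra. }
assert (N2 : 0 <= s ^ 2 - v ^ 2 <= 35 * v ^ 4).
{ split; [nra|].
  apply Rle_trans with ((v + 5 * v ^ 3) ^ 2 - v ^ 2).
  - assert (s ^ 2 <= (v + 5 * v ^ 3) ^ 2) by (apply pow_incr; lra). lra.
  - assert (0 < v ^ 4) by (apply pow_lt; lra).
    replace ((v + 5 * v ^ 3) ^ 2 - v ^ 2) with
      (10 * v ^ 4 + 25 * (v ^ 4 * v ^ 2)) by ring. nra. }
assert (N3 : 0 <= t ^ 2 - a ^ 2 <= t ^ 4 / 3).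
{ split; [nra|].
  replace (t ^ 2 - a ^ 2) with ((t - a) * (t + a)) by ring.
  replace (t ^ 4 / 3) with ((t ^ 3 / 6) * (2 * t)) by field.
  apply Rmult_le_compat; lra. }
replace (s * c / (s ^ 2 + a ^ 2) - v / (v ^ 2 + t ^ 2)) with
  (((s * c - v) * (v ^ 2 + t ^ 2) - v * (s ^ 2 - v ^ 2) + v * (t ^ 2 - a ^ 2))
   / ((s ^ 2 + a ^ 2) * (v ^ 2 + t ^ 2))) by (field; split; nra).
assert (HD : 0 < (s ^ 2 + a ^ 2) * (v ^ 2 + t ^ 2)) by nra.
rewrite Rabs_div, (Rabs_pos_eq (_ * _)) by lra.
apply Rmult_le_reg_r with ((s ^ 2 + a ^ 2) * (v ^ 2 + t ^ 2)); trivial.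
unfold Rdiv. rewrite Rmult_assoc, Rinv_l, Rmult_1_r by lra.
apply Rle_trans with (70 * v * (v ^ 2 + t ^ 2) ^ 2).
- set (w := v ^ 2 + t ^ 2) in *.
  assert (Q1 : 0 <= (s * c - v) * w <= 35 * v ^ 3 * w) by nra.
  assert (Q2 : 0 <= v * (s ^ 2 - v ^ 2) <= 35 * v ^ 5).
  { split; [nra|]. replace (35 * v ^ 5) with (v * (35 * v ^ 4)) by ring. nra. }
  assert (Q3 : 0 <= v * (t ^ 2 - a ^ 2) <= v * (t ^ 4 / 3)) by nra.
  assert (Q4 : 35 * v ^ 3 * w + 35 * v ^ 5 + v * (t ^ 4 / 3) <= 70 * v * w ^ 2).
  { unfold w.
    replace (35 * v ^ 3 * (v ^ 2 + t ^ 2) + 35 * v ^ 5 + v * (t ^ 4 / 3))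
      with (v * (70 * (v ^ 2) ^ 2 + 35 * v ^ 2 * t ^ 2 + (t ^ 2) ^ 2 / 3)) by field.
    replace (70 * v * (v ^ 2 + t ^ 2) ^ 2) with (v * (70 * (v ^ 2 + t ^ 2) ^ 2))
      by ring.
    apply Rmult_le_compat_l; [lra|].
    assert (0 <= t ^ 2) by nra. generalize dependent (t ^ 2).
    generalize dependent (v ^ 2). intros. nra. }
  apply Rabs_le. lra.
- replace (70 * v * (v ^ 2 + t ^ 2) ^ 2) with
    (630 * v * (((v ^ 2 + t ^ 2) / 9) * (v ^ 2 + t ^ 2))) by field.
  apply Rmult_le_compat; nra.
Qed.

(** Pairing k with 2p+1-k is what merges the two halves t and pi/2 - t of
    [re_coth_split]. *)
Lemma sum_fold (h : nat -> R) (p : nat) :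
  sum_f_R0 h (2 * p + 1) = sum_f_R0 (fun k => h k + h (2 * p + 1 - k)%nat) p.
Proof.
revert h. induction p as [|p IH]; intros h; [simpl; ring|].
rewrite decomp_sum by lia.
replace (pred (2 * S p + 1)) with (S (2 * p + 1)) by lia.
rewrite tech5, IH.
rewrite (decomp_sum _ (S p)) by lia. simpl pred.
replace (2 * S p + 1 - 0)%nat with (S (S (2 * p + 1))) by lia.
rewrite (sum_eq (fun k => h (S k) + h (S (2 * p + 1 - k)))
  (fun i => h (S i) + h (2 * S p + 1 - S i)%nat)).
- ring.
- intros i Hi. do 2 f_equal. lia.
Qed.

(** Halving splits the node i of the subdivision with p+1 intervals into the
    nodes i and 2(p+1) - i of the subdivision with 2(p+1) intervals.  The sums
    are over intervals, each contributing its two end points, so that the end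
    nodes 0 and pi/2 get half the weight of the others without separate
    treatment.  The subdivisions reached this way have 2^n intervals; only
    that they become arbitrarily fine is kept. *)
Lemma coth_trapezoid (n : nat) : exists p : nat, (n <= p)%nat /\
  forall u, 0 < u ->
  sum_f_R0 (fun k =>
    re_coth (u / (2 * INR (S p))) (PI * INR k / (2 * INR (S p))) +
    re_coth (u / (2 * INR (S p))) (PI * INR (S k) / (2 * INR (S p)))) p
  = 2 * INR (S p) * coth u.
Proof.
induction n as [|n [p [Hp IH]]].
- exists O. split; [lia|]. intros u Hu.
  simpl sum_f_R0. simpl INR. rewrite <- re_coth_0 by trivial.
  replace (PI * 0 / (2 * 1)) with 0 by field.
  replace (PI * 1 / (2 * 1)) with (PI / 2 - 0) by field.
  rewrite re_coth_split by lra.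
  replace (2 * (u / (2 * 1))) with u by field.
  rewrite Rmult_0_r. ring.
- exists (2 * p + 1)%nat. split; [lia|]. intros u Hu.
  assert (Hq : 0 < INR (S p)) by (apply lt_0_INR; lia).
  replace (INR (S (2 * p + 1))) with (2 * INR (S p))
    by (rewrite !S_INR, plus_INR, mult_INR; simpl; ring).
  rewrite Rmult_assoc, <- IH by trivial.
  rewrite sum_fold, scal_sum. apply sum_eq. intros k Hk.
  assert (Hsp : forall i, (i <= S p)%nat ->
    re_coth (u / (2 * (2 * INR (S p)))) (PI * INR i / (2 * (2 * INR (S p)))) +
    re_coth (u / (2 * (2 * INR (S p))))
      (PI * INR (2 * S p - i) / (2 * (2 * INR (S p)))) =
    2 * re_coth (u / (2 * INR (S p))) (PI * INR i / (2 * INR (S p)))).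
  { intros i Hi. rewrite minus_INR by lia. rewrite mult_INR.
    simpl (INR 2).
    replace (PI * ((1 + 1) * INR (S p) - INR i) / (2 * (2 * INR (S p))))
      with (PI / 2 - PI * INR i / (2 * (2 * INR (S p)))) by (field; lra).
    rewrite re_coth_split by (apply Rdiv_lt_0_compat; lra).
    do 2 f_equal; field; lra. }
  replace (2 * p + 1 - k)%nat with (2 * S p - S k)%nat by lia.
  replace (S (2 * S p - S k)) with (2 * S p - k)%nat by lia.
  assert (H1 := Hsp k ltac:(lia)). assert (H2 := Hsp (S k) ltac:(lia)). lra.
Qed.

(** Comparison with the telescoping terms 2 / (k (k+1)). *)
Lemma ex_series_inv_sqr : ex_series (fun k => / INR (S k) ^ 2).
Proof.
apply (ex_series_le (V := R_CompleteNormedModule) _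
  (fun k => 2 * (/ INR (S k) - / INR (S (S k))))).
- intros k. change (norm (/ INR (S k) ^ 2)) with (Rabs (/ INR (S k) ^ 2)).
  assert (H1 : 1 <= INR (S k)) by (change 1 with (INR 1); apply le_INR; lia).
  rewrite (S_INR (S k)). generalize dependent (INR (S k)). intros x Hx.
  rewrite Rabs_pos_eq by (left; apply Rinv_0_lt_compat; nra).
  replace (2 * (/ x - / (x + 1))) with (/ x ^ 2 + (x - 1) / (x ^ 2 * (x + 1)))
    by (field; nra).
  assert (0 <= (x - 1) / (x ^ 2 * (x + 1))) by (apply Rdiv_le_0_compat; nra).
  lra.
- apply (ex_series_scal (V := R_NormedModule) 2).
  exists 1.
  change (is_lim_seq (sum_n (fun k => / INR (S k) - / INR (S (S k)))) 1).
  apply (is_lim_seq_ext (fun n => 1 - / INR (S (S n)))).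
  + intros n. rewrite sum_n_Reals. induction n as [|n IH].
    * simpl. field.
    * rewrite tech5, <- IH. ring.
  + replace (Finite 1) with (Finite (1 - 0)) by (f_equal; ring).
    apply is_lim_seq_minus'; [apply is_lim_seq_const|].
    apply (is_lim_seq_inv _ p_infty); [|easy].
    apply (is_lim_seq_incr_1 (fun n => INR (S n))).
    apply (is_lim_seq_incr_1 INR). apply is_lim_seq_INR.
Qed.

(** With g k = u / (u^2 + (pi k)^2), the trapezoidal sums of g converge to
    g 0 + 2 sum_(k >= 1) g k, and g 0 = 1/u.  They also come arbitrarily close
    to coth u: by [re_coth_approx] at scale u / (2q) they differ from the exact
    trapezoidal formula by at most 700 u / (2q), where q is the number of
    intervals. *)
Lemma coth_partial_fractions (u : R) : 0 < u ->
  is_series (fun k => 2 * u / (u ^ 2 + (PI * INR (S k)) ^ 2)) (coth u - / u).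
Proof.
intros Hu. assert (HPI := PI_RGT_0).
set (g := fun k => u / (u ^ 2 + (PI * INR k) ^ 2)).
assert (Hex : exists G : R, is_series (fun k => g (S k)) G).
{ apply (ex_series_le (V := R_CompleteNormedModule) _
    (fun k => u / PI ^ 2 * / INR (S k) ^ 2)).
  - intros k. assert (Hk : 0 < INR (S k)) by (apply lt_0_INR; lia).
    change (norm (g (S k))) with (Rabs (g (S k))). unfold g.
    rewrite Rabs_pos_eq by (apply Rdiv_le_0_compat; nra).
    unfold Rdiv. rewrite Rmult_assoc, <- Rinv_mult, <- Rpow_mult_distr.
    apply Rmult_le_compat_l; [lra|].
    assert (0 < PI * INR (S k)) by nra.
    apply Rinv_le_contravar; nra.
  - apply (ex_series_scal (V := R_NormedModule)), ex_series_inv_sqr. }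
destruct Hex as [G HG].
assert (HG0 : is_series g (G + g O)).
{ apply is_series_decr_1.
  match goal with |- is_series _ ?x => replace x with G; trivial end.
  change (G = G + g O + - g O). ring. }
assert (Hg0 : g O = / u).
{ unfold g. simpl INR. field. lra. }
assert (HS : is_series (fun k => g k + g (S k)) ((G + g O) + G)).
{ exact (is_series_plus _ _ _ _ HG0 HG). }
assert (HL : coth u = (G + g O) + G).
{ apply cond_eq. intros eps Heps.
  apply is_series_Reals in HS.
  destruct (HS (eps / 2)) as [N HN]; [lra|].
  (* An index so large that u / (2q) <= 1 and the error is below eps / 2. *)
  destruct (nfloor_ex (700 * u / eps + u)) as [M HM].
  { assert (0 < 700 * u / eps) by (apply Rdiv_lt_0_compat; nra). lra. }
  destruct (coth_trapezoid (N + M)) as [p [Hp E]].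
  specialize (E u Hu). specialize (HN p ltac:(lia)).
  unfold Rdist in HN.
  assert (Hq : INR M + 1 <= INR (S p)).
  { rewrite S_INR. assert (INR M <= INR p) by (apply le_INR; lia). lra. }
  set (q := INR (S p)) in *.
  assert (Hqe : 700 * u / eps + u < q) by lra.
  assert (Hpe : 0 < 700 * u / eps) by (apply Rdiv_lt_0_compat; nra).
  assert (Hv : 0 < u / (2 * q) <= 1).
  { split; [apply Rdiv_lt_0_compat; lra|].
    apply Rmult_le_reg_r with (2 * q); [lra|].
    unfold Rdiv. rewrite Rmult_assoc, Rinv_l by lra. lra. }
  assert (Hk : forall k, (k <= S p)%nat ->
    Rabs (re_coth (u / (2 * q)) (PI * INR k / (2 * q)) - 2 * q * g k)
      <= 700 * (u / (2 * q))).
  { intros k Hk.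
    assert (HkS : 0 <= INR k <= q) by (split; [apply pos_INR|now apply le_INR]).
    replace (2 * q * g k) with
      (u / (2 * q) / ((u / (2 * q)) ^ 2 + (PI * INR k / (2 * q)) ^ 2)).
    - apply re_coth_approx; trivial. split.
      + apply Rdiv_le_0_compat; nra.
      + apply Rmult_le_reg_r with (2 * q); [lra|].
        unfold Rdiv. rewrite Rmult_assoc, Rinv_l by lra.
        generalize PI_4. nra.
    - unfold g. field. repeat split; nra. }
  assert (HA : Rabs (2 * q * coth u - 2 * q * sum_f_R0 (fun k => g k + g (S k)) p)
     <= 2 * q * (700 * (u / (2 * q)))).
  { rewrite <- E, scal_sum, <- minus_sum.
    eapply Rle_trans; [apply Rsum_abs|].
    apply Rle_trans with (sum_f_R0 (fun _ => 2 * (700 * (u / (2 * q)))) p).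
    - apply sum_Rle. intros k Hkp.
      assert (H1 := Hk k ltac:(lia)). assert (H2 := Hk (S k) ltac:(lia)).
      apply Rabs_le_between in H1. apply Rabs_le_between in H2.
      apply Rabs_le. lra.
    - rewrite sum_cte. fold q. lra. }
  rewrite <- Rmult_minus_distr_l, Rabs_mult, Rabs_pos_eq in HA by lra.
  apply Rmult_le_reg_l in HA; [|lra].
  assert (HB : 700 * (u / (2 * q)) < eps / 2).
  { apply Rmult_lt_reg_r with (2 * q / eps); [apply Rdiv_lt_0_compat; lra|].
    replace (700 * (u / (2 * q)) * (2 * q / eps)) with (700 * u / eps)
      by (field; lra).
    replace (eps / 2 * (2 * q / eps)) with q by (field; lra). lra. }
  apply Rabs_le_between in HA. apply Rabs_def2 in HN.
  apply Rabs_def1; lra. }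
replace (coth u - / u) with (2 * G) by lra.
apply (is_series_ext (fun k => scal 2 (g (S k)))).
- intros k. change (2 * g (S k) = 2 * u / (u ^ 2 + (PI * INR (S k)) ^ 2)).
  unfold g. unfold Rdiv. ring.
- apply (is_series_scal (V := R_NormedModule) 2 (fun k => g (S k)) G HG).
Qed.

(** * Zeta values at even integers and Bernoulli numbers *)

(** The value zeta(2k).  The series diverges at k = 0, where -1/2 is the value
    of the analytic continuation and the one that makes Euler's formula
    hold. *)
Definition zeta_even (k : nat) : R :=
  match k with
  | O => - / 2
  | _ => Series (fun i => / INR (S i) ^ (2 * k))
  end.

Lemma zeta_even_correct (k : nat) :
  is_series (fun i => / INR (S i) ^ (2 * S k)) (zeta_even (S k)).
Proof.
apply Series_correct.
apply (ex_series_le (V := R_CompleteNormedModule) _ (fun k => / INR (S k) ^ 2)).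
2: apply ex_series_inv_sqr.
intros i. change (Rabs (/ INR (S i) ^ (2 * S k)) <= / INR (S i) ^ 2).
assert (H1 : 1 <= INR (S i)) by (change 1 with (INR 1); apply le_INR; lia).
assert (H2 : 0 < INR (S i) ^ 2) by nra.
rewrite Rabs_pos_eq.
- apply Rinv_le_contravar; trivial. apply Rle_pow; [trivial|lia].
- left. apply Rinv_0_lt_compat, pow_lt. lra.
Qed.

(** Expands t / (t + k^2) as a geometric series in - t / k^2.  Instead of
    exchanging two infinite sums, the exact remainder after J terms is summed
    over k: it is at most t^J C in absolute value. *)
Lemma is_pseries_zeta_even (t C : R) : 0 <= t < 1 ->
  is_series (fun k => t / (t + INR (S k) ^ 2)) C ->
  is_pseries (fun n => - 2 * (-1) ^ n * zeta_even n) t (1 + 2 * C).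
Proof.
intros Ht HC.
set (P := sum_f_R0 (fun n => t ^ n * (- 2 * (-1) ^ n * zeta_even n))).
assert (HK : forall k, 1 <= INR (S k)).
{ intros k. change 1 with (INR 1). apply le_INR. lia. }
assert (HR : forall J, is_series
  (fun k => (- t) ^ J * (/ INR (S k) ^ (2 * J) * (t / (t + INR (S k) ^ 2))))
  ((1 + 2 * C - P J) / 2)).
{ induction J as [|J IH].
  - replace ((1 + 2 * C - P O) / 2) with C by (unfold P; simpl; field).
    revert HC. apply is_series_ext. intros k. simpl. field.
    specialize (HK k). simpl in HK. nra.
  - replace ((1 + 2 * C - P (S J)) / 2) with
      (plus ((1 + 2 * C - P J) / 2)
         (opp ((-1) ^ J * t ^ S J * zeta_even (S J)))).
    + refine (is_series_ext _ _ _ _ (is_series_plus _ _ _ _ IH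
        (is_series_opp _ _ (is_series_scal ((-1) ^ J * t ^ S J) _ _
           (zeta_even_correct J))))).
      intros k. specialize (HK k).
      change ((- t) ^ J * (/ INR (S k) ^ (2 * J) * (t / (t + INR (S k) ^ 2))) +
        - ((-1) ^ J * t ^ S J * / INR (S k) ^ (2 * S J)) =
        (- t) ^ S J * (/ INR (S k) ^ (2 * S J) * (t / (t + INR (S k) ^ 2)))).
      replace (- t) with (-1 * t) by ring. rewrite !Rpow_mult_distr.
      replace (2 * S J)%nat with (2 * J + 2)%nat by lia. rewrite pow_add.
      rewrite <- !tech_pow_Rmult. field.
      repeat split; try nra. apply pow_nonzero. lra.
    + change ((1 + 2 * C - P J) / 2 + - ((-1) ^ J * t ^ S J * zeta_even (S J)) =
        (1 + 2 * C - P (S J)) / 2).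
      unfold P. rewrite tech5. rewrite <- !tech_pow_Rmult. field. }
assert (HB : forall J, Rabs ((1 + 2 * C - P J) / 2) <= t ^ J * C).
{ intros J. rewrite <- (is_series_unique _ _ (HR J)).
  assert (HtJ : 0 <= t ^ J) by (apply pow_le; lra).
  assert (Hex : is_series (fun k => t ^ J * (t / (t + INR (S k) ^ 2))) (t ^ J * C))
    by exact (is_series_scal (V := R_NormedModule) (t ^ J) _ _ HC).
  assert (Hle : forall k, Rabs ((- t) ^ J *
      (/ INR (S k) ^ (2 * J) * (t / (t + INR (S k) ^ 2)))) <=
      t ^ J * (t / (t + INR (S k) ^ 2))).
  { intros k. specialize (HK k).
    rewrite Rabs_mult, <- RPow_abs, Rabs_Ropp, (Rabs_pos_eq t) by lra.
    apply Rmult_le_compat_l; trivial.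
    assert (0 <= t / (t + INR (S k) ^ 2)) by (apply Rdiv_le_0_compat; nra).
    assert (1 <= INR (S k) ^ (2 * J)) by now apply pow_R1_Rle.
    assert (0 < / INR (S k) ^ (2 * J)) by (apply Rinv_0_lt_compat; lra).
    assert (/ INR (S k) ^ (2 * J) <= 1).
    { rewrite <- Rinv_1. apply Rinv_le_contravar; lra. }
    rewrite Rabs_pos_eq by nra. nra. }
  eapply Rle_trans; [apply Series_Rabs|].
  - apply (ex_series_le (V := R_CompleteNormedModule) _
      (fun k => t ^ J * (t / (t + INR (S k) ^ 2)))).
    + intros k. change (Rabs (Rabs ((- t) ^ J *
        (/ INR (S k) ^ (2 * J) * (t / (t + INR (S k) ^ 2))))) <=
        t ^ J * (t / (t + INR (S k) ^ 2))).
      rewrite Rabs_Rabsolu. apply Hle.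
    + now exists (t ^ J * C).
  - rewrite <- (is_series_unique _ _ Hex). apply Series_le.
    + intros k. split; [apply Rabs_pos|apply Hle].
    + now exists (t ^ J * C). }
apply is_pseries_R.
change (is_lim_seq (sum_n (fun n => - 2 * (-1) ^ n * zeta_even n * t ^ n))
  (1 + 2 * C)).
apply (is_lim_seq_ext (fun J => (1 + 2 * C) - 2 * ((1 + 2 * C - P J) / 2))).
- intros J. rewrite sum_n_Reals. unfold P.
  rewrite (sum_eq (fun n => - 2 * (-1) ^ n * zeta_even n * t ^ n)
    (fun n => t ^ n * (- 2 * (-1) ^ n * zeta_even n))) by (intros; ring).
  field.
- replace (Finite (1 + 2 * C)) with (Finite ((1 + 2 * C) - 2 * 0))
    by (f_equal; ring).
  apply is_lim_seq_minus'; [apply is_lim_seq_const|].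
  apply (is_lim_seq_scal_l _ 2 (Finite 0)).
  apply is_lim_seq_abs_0.
  apply (is_lim_seq_le_le (fun _ => 0) _ (fun J => t ^ J * C)).
  + intros J. split; [apply Rabs_pos|apply HB].
  + apply is_lim_seq_const.
  + replace (Finite 0) with (Finite (0 * C)) by (f_equal; ring).
    apply (is_lim_seq_scal_r _ C (Finite 0)).
    apply is_lim_seq_geom. rewrite Rabs_pos_eq; lra.
Qed.

Lemma bernoulli_generating_coth (z : R) : z <> 0 ->
  z / (exp z - 1) = z / 2 * coth (z / 2) - z / 2.
Proof.
intros Hz.
assert (E : exp (z / 2) * exp (- (z / 2)) = 1).
{ rewrite <- exp_plus, Rplus_opp_r. apply exp_0. }
assert (E2 : exp z = exp (z / 2) * exp (z / 2)).
{ rewrite <- exp_plus. f_equal. field. }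
assert (He : exp z - 1 <> 0).
{ intros He. apply Hz. apply exp_inv. rewrite exp_0. lra. }
assert (Hp := exp_pos (z / 2)).
unfold coth, cosh, sinh.
replace (exp (- (z / 2))) with (/ exp (z / 2)).
2: { apply Rmult_eq_reg_l with (exp (z / 2)); [|lra]. rewrite E. field. lra. }
rewrite E2 in *. generalize dependent (exp (z / 2)). intros a. intros.
field. repeat split; try lra.
Qed.

(** Both sides are even in z, which gives the case z < 0. *)
Lemma coth_half_series (z : R) : z <> 0 ->
  is_series (fun k => (z / (2 * PI)) ^ 2 / ((z / (2 * PI)) ^ 2 + INR (S k) ^ 2))
    ((z / 2 * coth (z / 2) - 1) / 2).
Proof.
assert (HPI := PI_RGT_0).
assert (Hpos : forall z, 0 < z ->
  is_series (fun k => (z / (2 * PI)) ^ 2 / ((z / (2 * PI)) ^ 2 + INR (S k) ^ 2))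
    ((z / 2 * coth (z / 2) - 1) / 2)).
{ clear z. intros z Hz.
  assert (H := coth_partial_fractions (z / 2) ltac:(lra)).
  apply (is_series_scal (z / 4)) in H.
  replace ((z / 2 * coth (z / 2) - 1) / 2) with
    (scal (z / 4) (coth (z / 2) - / (z / 2))).
  - revert H. apply is_series_ext. intros k.
    change (z / 4 * (2 * (z / 2) / ((z / 2) ^ 2 + (PI * INR (S k)) ^ 2)) =
      (z / (2 * PI)) ^ 2 / ((z / (2 * PI)) ^ 2 + INR (S k) ^ 2)).
    assert (0 < INR (S k)) by (apply lt_0_INR; lia).
    field. repeat split; nra.
  - change (z / 4 * (coth (z / 2) - / (z / 2)) = (z / 2 * coth (z / 2) - 1) / 2).
    field. lra. }
intros Hz. destruct (Rlt_dec 0 z) as [H|H]; [now apply Hpos|].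
assert (Hm := Hpos (- z) ltac:(lra)).
replace (- z / 2 * coth (- z / 2)) with (z / 2 * coth (z / 2)) in Hm.
- revert Hm. apply is_series_ext. intros k.
  replace ((- z / (2 * PI)) ^ 2) with ((z / (2 * PI)) ^ 2); [easy|].
  field. lra.
- unfold coth, cosh, sinh. replace (- z / 2) with (- (z / 2)) by field.
  rewrite Ropp_involutive.
  replace ((exp (- (z / 2)) - exp (z / 2)) / 2)
    with (- ((exp (z / 2) - exp (- (z / 2))) / 2)) by field.
  replace (exp (- (z / 2)) + exp (z / 2))
    with (exp (z / 2) + exp (- (z / 2))) by ring.
  unfold Rdiv. rewrite Rinv_opp. ring.
Qed.

(** The Bernoulli numbers as Euler's formula predicts them. *)
Definition zeta_bernoulli (j : nat) : R :=
  INR (fact j) *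
  if Nat.even j then
    - 2 * (-1) ^ Nat.div2 j * zeta_even (Nat.div2 j) / (2 * PI) ^ j
  else if Nat.eqb j 1 then - / 2 else 0.

Lemma zeta_bernoulli_even (k : nat) :
  zeta_bernoulli (2 * k) / INR (fact (2 * k)) =
  - 2 * (-1) ^ k * zeta_even k / (2 * PI) ^ (2 * k).
Proof.
assert (HPI := PI_RGT_0). assert (Hf := INR_fact_neq_0 (2 * k)).
unfold zeta_bernoulli. rewrite Nat.even_even, Nat.div2_double.
field. split; [apply pow_nonzero; lra|trivial].
Qed.

Lemma is_bernoulli_zeta : is_bernoulli zeta_bernoulli.
Proof.
assert (HPI := PI_RGT_0).
exists (mkposreal 1 Rlt_0_1). intros z Hz Hz0.
assert (Hz1 : Rabs z < 1).
{ change (Rabs (z - 0) < 1) in Hz. now rewrite Rminus_0_r in Hz. }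
set (t := (z / (2 * PI)) ^ 2).
assert (Ht : 0 <= t < 1).
{ unfold t. split; [apply pow2_ge_0|].
  rewrite <- (pow1 2), <- pow2_abs.
  assert (Rabs (z / (2 * PI)) < 1).
  { rewrite Rabs_div by lra. rewrite (Rabs_pos_eq (2 * PI)) by lra.
    apply Rmult_lt_reg_r with (2 * PI); [lra|].
    unfold Rdiv. rewrite Rmult_assoc, Rinv_l by lra.
    generalize PI2_3_2. lra. }
  generalize (Rabs_pos (z / (2 * PI))). nra. }
assert (HE := is_pseries_zeta_even t _ Ht (coth_half_series z Hz0)).
rewrite bernoulli_generating_coth by trivial.
replace (z / 2 * coth (z / 2) - z / 2) with
  ((1 + 2 * ((z / 2 * coth (z / 2) - 1) / 2)) + z * (- / 2)) by field.
apply is_pseries_odd_even.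
- apply is_pseries_R. apply is_pseries_R in HE.
  revert HE. apply is_series_ext. intros n.
  change (- 2 * (-1) ^ n * zeta_even n * t ^ n =
    zeta_bernoulli (2 * n) / INR (fact (2 * n)) * (z ^ 2) ^ n).
  rewrite zeta_bernoulli_even, pow_mult. unfold t.
  assert (Hn : ((2 * PI) ^ 2) ^ n <> 0) by (apply pow_nonzero; nra).
  replace ((z / (2 * PI)) ^ 2) with (z ^ 2 * / (2 * PI) ^ 2) by (field; lra).
  rewrite Rpow_mult_distr, pow_inv. now field.
- apply is_pseries_R.
  assert (Hodd : forall n, zeta_bernoulli (2 * n + 1) / INR (fact (2 * n + 1)) =
    match n with O => - / 2 | _ => 0 end).
  { intros n. assert (Hf := INR_fact_neq_0 (2 * n + 1)).
    unfold zeta_bernoulli. rewrite Nat.even_odd.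
    destruct n as [|n]; [simpl; field|].
    replace (Nat.eqb (2 * S n + 1) 1) with false; [now field|].
    symmetry. apply Nat.eqb_neq. lia. }
  change (is_lim_seq (sum_n (fun n => zeta_bernoulli (2 * n + 1) /
    INR (fact (2 * n + 1)) * (z ^ 2) ^ n)) (- / 2)).
  apply (is_lim_seq_ext (fun _ => - / 2)); [|apply is_lim_seq_const].
  intros n. rewrite sum_n_Reals. induction n as [|n IH].
  + cbn [sum_f_R0]. rewrite Hodd. simpl. ring.
  + rewrite tech5, <- IH, Hodd. ring.
Qed.

(** Euler's formula for zeta(2k), divided by (2k)!. *)
Lemma bernoulli_even (B : nat -> R) (k : nat) : is_bernoulli B ->
  B (2 * k)%nat / INR (fact (2 * k)) =
  - 2 * (-1) ^ k * zeta_even k / (2 * PI) ^ (2 * k).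
Proof.
intros HB. rewrite <- zeta_bernoulli_even.
now rewrite (is_bernoulli_unique _ _ HB is_bernoulli_zeta).
Qed.

(** * The symmetric double series *)

Lemma sum_nonneg_mono (h : nat -> R) (K M : nat) :
  (forall k, 0 <= h k) -> (K <= M)%nat -> sum_f_R0 h K <= sum_f_R0 h M.
Proof.
intros Hh H. induction H as [|M H IH]; [lra|].
rewrite tech5. specialize (Hh (S M)). lra.
Qed.

(** For non-negative terms the partial sums of the row sums are squeezed between
    the square sums and their limit L. *)
Lemma is_series_of_square_sums (a : nat -> nat -> R) (r : nat -> R) (L : R) :
  (forall n k, 0 <= a n k) ->
  (forall n, is_series (a n) (r n)) ->
  is_lim_seq (fun N => sum_f_R0 (fun n => sum_f_R0 (a n) N) N) L ->
  is_series r L.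
Proof.
intros Ha Hr HL.
set (sq := fun N => sum_f_R0 (fun n => sum_f_R0 (a n) N) N) in *.
assert (Hrow : forall n K, sum_f_R0 (a n) K <= r n).
{ intros n K. apply sum_incr; [|apply Ha].
  apply is_lim_seq_Reals.
  apply (is_lim_seq_ext (sum_n (a n))); [apply sum_n_Reals|]. exact (Hr n). }
assert (Hmono : forall N K M, (N <= M)%nat -> (K <= M)%nat ->
  sum_f_R0 (fun n => sum_f_R0 (a n) K) N <= sq M).
{ intros N K M HN HK. unfold sq.
  apply Rle_trans with (sum_f_R0 (fun n => sum_f_R0 (a n) M) N).
  - apply sum_Rle. intros n _. now apply sum_nonneg_mono.
  - apply sum_nonneg_mono; trivial. intros n. now apply cond_pos_sum. }
assert (HsqL : forall N, sq N <= L).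
{ intros N. apply (is_lim_seq_incr_compare sq L HL).
  intros n. unfold sq at 1. apply Hmono; lia. }
change (is_lim_seq (sum_n r) L).
apply (is_lim_seq_le_le sq _ (fun _ => L)); trivial.
2: apply is_lim_seq_const.
intros N. rewrite sum_n_Reals. split.
- unfold sq. apply sum_Rle. intros n _. apply Hrow.
- apply (is_lim_seq_le_loc (fun K => sum_f_R0 (fun n => sum_f_R0 (a n) K) N)
    (fun _ => L) (sum_f_R0 r N) L).
  + exists N. intros K HK. apply Rle_trans with (sq K); trivial.
    apply Hmono; lia.
  + induction N as [|N IH].
    * apply (is_lim_seq_ext (sum_n (a O))); [apply sum_n_Reals|]. exact (Hr O).
    * simpl sum_f_R0. apply is_lim_seq_plus'; trivial.
      apply (is_lim_seq_ext (sum_n (a (S N)))); [apply sum_n_Reals|].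
      exact (Hr (S N)).
  + apply is_lim_seq_const.
Qed.

(** The factorisation of Y^(n+1) +/- X^(n+1) by X + Y. *)
Lemma alternating_power_sum (X Y : R) (n : nat) :
  (X + Y) * sum_f_R0 (fun j => (-1) ^ j * X ^ j * Y ^ (n - j)) n =
  Y ^ S n + (-1) ^ n * X ^ S n.
Proof.
induction n as [|n IH]; [simpl; ring|].
rewrite tech5, Nat.sub_diag.
rewrite (sum_eq _ (fun j => (-1) ^ j * X ^ j * Y ^ (n - j) * Y)).
- rewrite <- scal_sum, Rmult_plus_distr_l.
  replace ((X + Y) * (Y * sum_f_R0 (fun j => (-1) ^ j * X ^ j * Y ^ (n - j)) n))
    with (Y * (Y ^ S n + (-1) ^ n * X ^ S n)) by (rewrite <- IH; ring).
  simpl. ring.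
- intros j Hj. replace (S n - j)%nat with (S (n - j)) by lia. simpl. ring.
Qed.

(** With X = 1/x^2 and Y = 1/y^2 the left-hand side is
    X Y (X^(2m+1) + Y^(2m+1)) / (X + Y); the odd exponent makes the division
    exact. *)
Lemma kernel_symmetrised (x y : R) (m : nat) : 0 < x -> 0 < y ->
  / (x ^ (4 * m + 2) * (x ^ 2 + y ^ 2)) + / (y ^ (4 * m + 2) * (y ^ 2 + x ^ 2)) =
  sum_f_R0 (fun j => (-1) ^ j * (/ x ^ (2 * S j) * / y ^ (2 * S (2 * m - j))))
    (2 * m).
Proof.
intros Hx Hy.
assert (E := alternating_power_sum (/ x ^ 2) (/ y ^ 2) (2 * m)).
rewrite pow_1_even, Rmult_1_l in E.
rewrite (sum_eq _ (fun j => (-1) ^ j * (/ x ^ 2) ^ j * (/ y ^ 2) ^ (2 * m - j) *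
  (/ x ^ 2 * / y ^ 2))).
2: { intros j _. rewrite !pow_mult, <- !tech_pow_Rmult, !pow_inv.
     assert ((x ^ 2) ^ j <> 0) by (apply pow_nonzero; nra).
     assert ((y ^ 2) ^ (2 * m - j) <> 0) by (apply pow_nonzero; nra).
     field. repeat split; try nra; trivial. }
rewrite <- scal_sum.
assert (Hs : / x ^ 2 + / y ^ 2 <> 0).
{ assert (0 < / x ^ 2) by (apply Rinv_0_lt_compat; nra).
  assert (0 < / y ^ 2) by (apply Rinv_0_lt_compat; nra). lra. }
apply Rmult_eq_reg_l with (/ x ^ 2 + / y ^ 2); trivial.
rewrite Rmult_comm with (r1 := / x ^ 2 * / y ^ 2), <- Rmult_assoc, E, !pow_inv.
rewrite <- !pow_mult. replace (2 * S (2 * m))%nat with (4 * m + 2)%nat by lia.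
assert (x ^ (4 * m + 2) <> 0) by (apply pow_nonzero; nra).
assert (y ^ (4 * m + 2) <> 0) by (apply pow_nonzero; nra).
field. repeat split; try nra; trivial.
Qed.

Lemma sum_f_R0_exchange (f : nat -> nat -> R) (N M : nat) :
  sum_f_R0 (fun i => sum_f_R0 (f i) M) N =
  sum_f_R0 (fun j => sum_f_R0 (fun i => f i j) N) M.
Proof.
induction N as [|N IH]; [easy|].
rewrite tech5, IH, <- sum_plus. now apply sum_eq.
Qed.

Lemma is_lim_seq_sum (f : nat -> nat -> R) (l : nat -> R) (M : nat) :
  (forall j, is_lim_seq (f j) (l j)) ->
  is_lim_seq (fun N => sum_f_R0 (fun j => f j N) M) (sum_f_R0 l M).
Proof.
intros H. induction M as [|M IH]; [apply H|].
simpl. now apply is_lim_seq_plus'.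
Qed.

Lemma zeta_even_sum (k : nat) :
  is_lim_seq (sum_f_R0 (fun i => / INR (S i) ^ (2 * S k))) (zeta_even (S k)).
Proof.
apply (is_lim_seq_ext (sum_n (fun i => / INR (S i) ^ (2 * S k)))).
- apply sum_n_Reals.
- exact (zeta_even_correct k).
Qed.

(** A square is stable under exchanging n and k, so the summand may be replaced
    by its symmetrisation, after which the sum is a combination of products of
    partial sums of zeta series. *)
Lemma square_sums_limit (m : nat) :
  is_lim_seq (fun N => sum_f_R0 (fun n => sum_f_R0 (fun k =>
      2 * / (INR (S n) ^ (4 * m + 2) * (INR (S n) ^ 2 + INR (S k) ^ 2))) N) N)
    (sum_f_R0 (fun j =>
       (-1) ^ j * (zeta_even (S j) * zeta_even (S (2 * m - j)))) (2 * m)).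
Proof.
set (z := fun j => sum_f_R0 (fun i => / INR (S i) ^ (2 * S j))).
apply (is_lim_seq_ext (fun N => sum_f_R0 (fun j =>
  (-1) ^ j * (z j N * z (2 * m - j)%nat N)) (2 * m))).
- intros N.
  set (a := fun n k =>
    / (INR (S n) ^ (4 * m + 2) * (INR (S n) ^ 2 + INR (S k) ^ 2))).
  transitivity (sum_f_R0 (fun n => sum_f_R0 (fun k => a n k + a k n) N) N).
  + rewrite (sum_eq (fun n => sum_f_R0 (fun k => a n k + a k n) N)
      (fun n => sum_f_R0 (fun j => (-1) ^ j *
         (/ INR (S n) ^ (2 * S j) * z (2 * m - j)%nat N)) (2 * m))).
    * rewrite sum_f_R0_exchange. apply sum_eq. intros j _.
      unfold z at 1. rewrite (Rmult_comm (sum_f_R0 _ N)), scal_sum, scal_sum.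
      apply sum_eq. intros n _. ring.
    * intros n _.
      rewrite (sum_eq _ (fun k => sum_f_R0 (fun j => (-1) ^ j *
        (/ INR (S n) ^ (2 * S j) * / INR (S k) ^ (2 * S (2 * m - j)))) (2 * m))).
      2: { intros k _. apply kernel_symmetrised; apply lt_0_INR; lia. }
      rewrite sum_f_R0_exchange. apply sum_eq. intros j _.
      unfold z. rewrite <- Rmult_assoc, scal_sum. apply sum_eq. intros k _. ring.
  + rewrite (sum_eq (fun n => sum_f_R0 (fun k => a n k + a k n) N)
      (fun n => sum_f_R0 (a n) N + sum_f_R0 (fun k => a k n) N))
      by (intros; apply sum_plus).
    rewrite sum_plus, (sum_f_R0_exchange (fun n k => a k n)).
    rewrite <- sum_plus. apply sum_eq. intros n _.
    rewrite <- sum_plus. apply sum_eq. intros k _. unfold a. ring.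
- apply is_lim_seq_sum. intros j.
  apply (is_lim_seq_scal_l _ ((-1) ^ j)
    (Finite (zeta_even (S j) * zeta_even (S (2 * m - j))))).
  apply is_lim_seq_mult'; apply zeta_even_sum.
Qed.

(** The row sums of the double series are given by the expansion of
    coth (pi n), multiplied by pi / n^(4m+3). *)
Lemma coth_series_zeta (m : nat) :
  is_series
    (fun i => coth (PI * INR (S i)) / INR (S i) ^ (4 * m + 3))
    (/ PI * (zeta_even (S (2 * m + 1)) + sum_f_R0 (fun j =>
       (-1) ^ j * (zeta_even (S j) * zeta_even (S (2 * m - j)))) (2 * m))).
Proof.
assert (HPI := PI_RGT_0).
assert (HK : forall k, 0 < INR (S k)) by (intros; apply lt_0_INR; lia).
set (r := fun n => PI * coth (PI * INR (S n)) / INR (S n) ^ (4 * m + 3) -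
                   / INR (S n) ^ (2 * S (2 * m + 1))).
assert (Hrow : forall n, is_series (fun k =>
  2 * / (INR (S n) ^ (4 * m + 2) * (INR (S n) ^ 2 + INR (S k) ^ 2))) (r n)).
{ intros n. specialize (HK n) as Hn.
  assert (H := coth_partial_fractions (PI * INR (S n)) ltac:(nra)).
  apply (is_series_scal (PI / INR (S n) ^ (4 * m + 3))) in H.
  assert (Hp : INR (S n) ^ (4 * m + 2) <> 0) by (apply pow_nonzero; lra).
  assert (E3 : INR (S n) ^ (4 * m + 3) = INR (S n) * INR (S n) ^ (4 * m + 2)).
  { now replace (4 * m + 3)%nat with (S (4 * m + 2)) by lia. }
  replace (r n) with (scal (PI / INR (S n) ^ (4 * m + 3))
    (coth (PI * INR (S n)) - / (PI * INR (S n)))).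
  - revert H. apply is_series_ext. intros k. specialize (HK k).
    change (PI / INR (S n) ^ (4 * m + 3) * (2 * (PI * INR (S n)) /
      ((PI * INR (S n)) ^ 2 + (PI * INR (S k)) ^ 2)) =
      2 * / (INR (S n) ^ (4 * m + 2) * (INR (S n) ^ 2 + INR (S k) ^ 2))).
    assert (0 < PI * INR (S n)) by nra. assert (0 < PI * INR (S k)) by nra.
    clear HK. rewrite E3. field. repeat split; trivial. all: try nra.
  - change (PI / INR (S n) ^ (4 * m + 3) *
      (coth (PI * INR (S n)) - / (PI * INR (S n))) = r n).
    unfold r. replace (2 * S (2 * m + 1))%nat with (S (S (4 * m + 2))) by lia.
    rewrite E3, <- !tech_pow_Rmult. field. repeat split; trivial; lra. }
assert (HS := is_series_of_square_sums _ _ _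
  (fun n k => Rlt_le _ _ (Rmult_lt_0_compat _ _ Rlt_0_2 (Rinv_0_lt_compat _
     (Rmult_lt_0_compat _ _ (pow_lt _ _ (HK n))
        (Rplus_lt_0_compat _ _ (pow_lt _ 2 (HK n)) (pow_lt _ 2 (HK k)))))))
  Hrow (square_sums_limit m)).
assert (HT := is_series_scal (V := R_NormedModule) (/ PI) _ _
  (is_series_plus _ _ _ _ (zeta_even_correct (2 * m + 1)) HS)).
revert HT. apply is_series_ext. intros n.
change (/ PI * (/ INR (S n) ^ (2 * S (2 * m + 1)) + r n) =
  coth (PI * INR (S n)) / INR (S n) ^ (4 * m + 3)).
assert (INR (S n) ^ (4 * m + 3) <> 0) by (apply pow_nonzero; specialize (HK n); lra).
unfold r. generalize (/ INR (S n) ^ (2 * S (2 * m + 1))). intros A.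
field. now split; [|lra].
Qed.

(** * Comparison with the Bernoulli sum *)

Theorem proposition1p2 :
  forall (B : nat -> R) (m : nat),
    is_bernoulli B -> (1 <= m)%nat ->
    is_series
      (fun i : nat => coth (PI * INR (S i)) / INR (S i) ^ (4 * m + 3))
      (2 ^ (4 * m + 2) * PI ^ (4 * m + 3) *
       sum_f_R0
         (fun k : nat =>
            (-1) ^ (k + 1) * B (2 * k)%nat * B (4 * m + 4 - 2 * k)%nat /
            (INR (fact (2 * k)) * INR (fact (4 * m + 4 - 2 * k))))
         (2 * m + 2)).
Proof.
intros B m HB _. assert (HPI := PI_RGT_0).
match goal with |- is_series _ ?x => replace x with
  (/ PI * (zeta_even (S (2 * m + 1)) + sum_f_R0 (fun j =>
       (-1) ^ j * (zeta_even (S j) * zeta_even (S (2 * m - j)))) (2 * m))) end.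
{ apply coth_series_zeta. }
rewrite (sum_eq _ (fun k => (-1) ^ (k + 1) * (zeta_even k *
  zeta_even (2 * m + 2 - k)) * (4 / (2 * PI) ^ (4 * m + 4))) (2 * m + 2)).
- rewrite <- scal_sum.
  (* Both zeta factors carry 2 / (2 pi)^(..), whence the factor 4. *)
  replace (2 ^ (4 * m + 2) * PI ^ (4 * m + 3)) with
    (/ PI * ((2 * PI) ^ (4 * m + 4) / 4)).
  2: { rewrite Rpow_mult_distr. replace (4 * m + 4)%nat with (S (S (4 * m + 2))) by lia.
    replace (4 * m + 3)%nat with (S (4 * m + 2)) by lia. simpl pow. field. lra. }
  assert (Hp : (2 * PI) ^ (4 * m + 4) <> 0) by (apply pow_nonzero; lra).
  rewrite <- Rmult_assoc.
  replace (/ PI * ((2 * PI) ^ (4 * m + 4) / 4) * (4 / (2 * PI) ^ (4 * m + 4)))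
    with (/ PI) by (field; lra).
  f_equal.
  replace (2 * m + 2)%nat with (S (S (2 * m))) by lia.
  (* The end terms k = 0 and k = 2m+2 each give half of zeta(4m+4). *)
  rewrite tech5, (decomp_sum _ (S (2 * m))) by lia.
  rewrite Nat.pred_succ.
  rewrite Nat.sub_diag.
  replace (S (S (2 * m)) - 0)%nat with (S (2 * m + 1)) by lia.
  replace (S (S (2 * m))) with (S (2 * m + 1)) by lia.
  replace (S (2 * m + 1) + 1)%nat with (S (2 * (m + 1))) by lia.
  rewrite pow_1_odd.
  rewrite (sum_eq (fun i => (-1) ^ (S i + 1) *
      (zeta_even (S i) * zeta_even (S (2 * m + 1) - S i)))
    (fun j => (-1) ^ j * (zeta_even (S j) * zeta_even (S (2 * m - j))))).
  + change (zeta_even 0) with (- / 2).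
    change ((-1) ^ (0 + 1)) with (-1 * 1). field.
  + intros j Hj. replace (S (2 * m + 1) - S j)%nat with (S (2 * m - j)) by lia.
    rewrite pow_add. simpl pow. ring.
- intros k Hk.
  assert (Hf1 := INR_fact_neq_0 (2 * k)).
  assert (Hf2 := INR_fact_neq_0 (4 * m + 4 - 2 * k)).
  replace ((-1) ^ (k + 1) * B (2 * k)%nat * B (4 * m + 4 - 2 * k)%nat /
            (INR (fact (2 * k)) * INR (fact (4 * m + 4 - 2 * k)))) with
    ((-1) ^ (k + 1) * ((B (2 * k)%nat / INR (fact (2 * k))) *
      (B (4 * m + 4 - 2 * k)%nat / INR (fact (4 * m + 4 - 2 * k)))))
    by (field; now split).
  replace (4 * m + 4 - 2 * k)%nat with (2 * (2 * m + 2 - k))%nat by lia.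
  rewrite !bernoulli_even by trivial.
  replace (4 * m + 4)%nat with (2 * k + 2 * (2 * m + 2 - k))%nat by lia.
  rewrite (pow_add (2 * PI)).
  (* The two indices k and 2m+2-k have the same parity: the signs cancel. *)
  assert (Hs : (-1) ^ k * (-1) ^ (2 * m + 2 - k) = 1).
  { rewrite <- pow_add. replace (k + (2 * m + 2 - k))%nat with (2 * (m + 1))%nat by lia.
    apply pow_1_even. }
  assert ((2 * PI) ^ (2 * k) <> 0) by (apply pow_nonzero; lra).
  assert ((2 * PI) ^ (2 * (2 * m + 2 - k)) <> 0) by (apply pow_nonzero; lra).
  rewrite <- (Rmult_1_r ((-1) ^ (k + 1))) at 2. rewrite <- Hs.
  field. now split.
Qed.
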